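(* Let $\mathcal A$ be a supersolvable hyperplane arrangement of rank $d$, and let $B$ be a canonical base region. Then the poset of regions $\mathcal P(\mathcal A,B)$ has a zonotopal embedding in $\mathbb R^d$.
   Context: A (central) arrangement $\mathcal A$ is a finite, nonempty collection of codimension-1 linear subspaces (hyperplanes) of $\mathbb R^n$. $\mathrm{Span}(\mathcal A)$ is the linear span of the normal vectors of $\mathcal A$ and the rank of $\mathcal A$ is $\dim\mathrm{Span}(\mathcal A)$. Its regions are the closures of the connected components of $\mathbb R^n\setminus\bigcup_{H\in\mathcal A}H$. Fix a region $B$, the base region. For a region $R$, the separating set $S(R)$ is the set of hyperplanes of $\mathcal A$ separating $R$ from $B$. The poset of regions $\mathcal P(\mathcal A,B)$ is the set of regions with $R_1\le R_2$ if and only if $S(R_1)\subseteq S(R_2)$. Supersolvable arrangements are characterized (and may be defined) recursively. Every arrangement of rank 1 or 2 is supersolvable. An arrangement $\mathcal A$ of rank $d\ge2$ is supersolvable if and only if it can be written as a disjoint union $\mathcal A=\mathcal A_0\uplus\mathcal A_1$ where (i) $\mathcal A_0$ is a supersolvable arrangement of rank $d-1$, and (ii) for any distinct $H',H''\in\mathcal A_1$ there is a unique $H\in\mathcal A_0$ with $H'\cap H''\subseteq H$. Canonical base regions are defined inductively. Any region of an arrangement of rank 1 or 2 is a canonical base region. For a supersolvable arrangement $\mathcal A=\mathcal A_0\uplus\mathcal A_1$ (with (i) and (ii)) of rank at least 3 and a region $B$ of $\mathcal A$, let $B_0$ be the region of $\mathcal A_0$ containing $B$; then $B$ is a canonical base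 region if $B_0$ is a canonical base region of $\mathcal A_0$ and the regions of $\mathcal A$ contained in $B_0$ are linearly ordered in $\mathcal P(\mathcal A,B)$. Zonotopal embedding: for each $H\in\mathcal A$ choose a normal vector $n_H$ to $H$, directed so that for each region $R$, $S(R)$ is exactly the set of $H\in\mathcal A$ with $\langle x,n_H\rangle>0$ for every $x$ in the interior of $R$; the lengths of the $n_H$ may be chosen freely (scaling by positive constants). Set $Z(R)=\sum_{H\in S(R)}n_H$. Choose a basis $b_1,\ldots,b_d$ of $\mathrm{Span}(\mathcal A)\cong\mathbb R^d$, and let $Z_i(R)$ be the coefficient of $b_i$ in the expansion of $Z(R)$ in this basis. The map $Z$ is a zonotopal embedding of $\mathcal P(\mathcal A,B)$ in $\mathbb R^d$ if for every pair of regions, $R_1\le R_2$ if and only if $Z_i(R_1)\le Z_i(R_2)$ for all $i\in\{1,\ldots,d\}$. To say that $\mathcal P(\mathcal A,B)$ has a zonotopal embedding in $\mathbb R^d$ means that some choice of scaling of the normals and some choice of basis make $Z$ a zonotopal embedding. *)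

(* Defs.v *)
From HB Require Import structures.
From mathcomp Require Import all_boot all_order all_algebra finmap.
From mathcomp Require Import all_classical all_reals all_analysis.

Set Implicit Arguments.
Unset Strict Implicit.
Unset Printing Implicit Defensive.

Import Order.TTheory GRing.Theory Num.Theory.
Import numFieldNormedType.Exports.

Local Open Scope classical_set_scope.
Local Open Scope ring_scope.

Section Arrangements.
Variables (R : realType) (n : nat).

Local Notation E := 'rV[R]_n.
Implicit Types (A : {fset {vspace E}}) (H U : {vspace E}) (Q B : set E).

Definition dotv (u v : E) : R := \sum_i u 0 i * v 0 i.

Fact dotv_linear u : linear (dotv u : E -> R^o).
Proof.
move=> a v w; rewrite /dotv scaler_sumr -big_split; apply: eq_bigr => i _ /=.
by rewrite !mxE mulrDr mulrCA.
Qed.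
HB.instance Definition _ u :=
  @GRing.isLinear.Build R E R^o *:%R (dotv u : E -> R^o) (dotv_linear u).

Definition orthv U : {vspace E} :=
  (\bigcap_(u <- vbasis U) lker (linfun (dotv u : E -> R^o)))%VS.

Lemma orthvP U v : reflect {in U, forall u, dotv u v = 0} (v \in orthv U).
Proof.
have mem_big (s : seq E) :
    v \in (\bigcap_(u <- s) lker (linfun (dotv u : E -> R^o)))%VS
    = all (fun u => dotv u v == 0) s.
  elim: s => [|u s IHs]; first by rewrite big_nil memvf.
  by rewrite big_cons memv_cap memv_ker lfunE IHs.
rewrite /orthv mem_big; apply: (iffP allP) => [hv u uU | hv u us]; last first.
  by apply/eqP/hv/vbasis_mem.
have dotC (x y : E) : dotv x y = dotv y x.
  by apply: eq_bigr => i _; rewrite mulrC.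
rewrite dotC (coord_vbasis uU) (linear_sum (dotv v : {linear E -> R^o})) /=.
apply: big1 => i _.
rewrite (linearZ_LR (dotv v : {linear E -> R^o})) /= dotC.
by rewrite (eqP (hv _ _)) ?scaler0 // mem_nth // size_tuple.
Qed.

(* Codimension 1 is written without subtraction, so that n = 0 is excluded. *)
Definition arrangement A : Prop :=
  A <> fset0 /\ forall H, H \in A -> (\dim H).+1 = n.

Definition is_normal H (v : E) : Prop := v != 0 /\ v \in orthv H.

(* For a hyperplane H, the nonzero vectors of orthv H are its normal vectors. *)
Definition Span A : {vspace E} := (\sum_(H <- enum_fset A) orthv H)%VS.

Definition rank A : nat := \dim (Span A).

Definition complement A : set E := [set x | forall H, H \in A -> x \notin H].

Definition region A Q : Prop :=
  exists2 x, complement A x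
           & Q = closure (connected_component (complement A) x).

Definition separates H Q B : Prop :=
  exists v, [/\ is_normal H v,
    forall x, interior Q x -> 0 < dotv x v
  & forall x, interior B x -> dotv x v < 0].

Definition sepset A B Q : {fset {vspace E}} :=
  [fset H in A | `[< separates H Q B >]]%fset.

Definition region_le A B Q1 Q2 : Prop :=
  (sepset A B Q1 `<=` sepset A B Q2)%fset.

Definition modular_split A A0 A1 : Prop :=
  [/\ A = (A0 `|` A1)%fset,
      [disjoint A0 & A1]%fset,
      rank A = (rank A0).+1
    & forall H1 H2, H1 \in A1 -> H2 \in A1 -> H1 <> H2 ->
        exists! H, H \in A0 /\ (H1 :&: H2 <= H)%VS].

Inductive supersolvable : {fset {vspace E}} -> Prop :=
| supersolvable_low A of arrangement A & rank A = 1%N \/ rank A = 2%N :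
    supersolvable A
| supersolvable_step A A0 A1 of arrangement A & (2 <= rank A)%N
    & modular_split A A0 A1 & supersolvable A0 :
    supersolvable A.

Inductive canonical_base : {fset {vspace E}} -> set E -> Prop :=
| canonical_base_low A B of arrangement A & rank A = 1%N \/ rank A = 2%N
    & region A B :
    canonical_base A B
| canonical_base_step A A0 A1 B B0 of arrangement A & (3 <= rank A)%N
    & modular_split A A0 A1 & supersolvable A0
    & region A B & region A0 B0 & B `<=` B0
    & canonical_base A0 B0
    & (forall Q1 Q2, region A Q1 -> region A Q2 -> Q1 `<=` B0 -> Q2 `<=` B0 ->
         region_le A B Q1 Q2 \/ region_le A B Q2 Q1) :
    canonical_base A B.

Definition directed_normals A B (nu : {vspace E} -> E) : Prop :=
  (forall H, H \in A -> is_normal H (nu H)) /\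
  forall Q H, region A Q -> H \in A ->
    (H \in sepset A B Q <-> forall x, interior Q x -> 0 < dotv x (nu H)).

Definition zono A B (nu : {vspace E} -> E) Q : E :=
  \sum_(H <- enum_fset (sepset A B Q)) nu H.

Definition zonotopal_embedding A B d (nu : {vspace E} -> E)
    (b : d.-tuple E) : Prop :=
  forall Q1 Q2, region A Q1 -> region A Q2 ->
    (region_le A B Q1 Q2 <->
     forall i : 'I_d,
       coord b i (zono A B nu Q1) <= coord b i (zono A B nu Q2)).

Definition has_zonotopal_embedding A B d : Prop :=
  exists (nu : {vspace E} -> E) (b : d.-tuple E),
    [/\ directed_normals A B nu, basis_of (Span A) b
      & zonotopal_embedding A B nu b].

End Arrangements.

(* Main.v *)
Require Import Defs.
From mathcomp Require Import all_boot all_order all_algebra finmap.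
From mathcomp Require Import all_classical all_reals all_analysis.
From mathcomp Require Import ring lra.

Set Implicit Arguments.
Unset Strict Implicit.
Unset Printing Implicit Defensive.

Import Order.TTheory GRing.Theory Num.Theory.
Import numFieldNormedType.Exports.

Local Open Scope classical_set_scope.
Local Open Scope ring_scope.

(** The base region enters only through a point [p] of its interior, a region
    only through a point [x] of its interior, and the separating set of [x] is
    the set [S x] of the hyperplanes whose normal [nu H], directed by
    [<p, nu H> < 0], satisfies [<x, nu H> > 0].  Instead of a basis, the dual
    basis is constructed: a list [f] of vectors such that the functionals
    [<g, _>], [g] in [f], separate the points of [Span A]; then [dual_basis]
    applies.

    The induction goes along the splitting [A = A0 + A1] of a canonical base
    region.  A vector [v] orthogonal to [Span A0] but not to [Span A] is
    orthogonal to no normal of [A1] ([splitting_direction]).  Far away from [p]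
    in the directions [v] and [-v] there are two regions of [A] inside the
    region of [A0] containing [p]; as these are comparable, [v] is, up to sign,
    positive on all directed normals of [A1] ([chain_direction]).  Thus the ray
    from [p] in the direction [v] crosses every hyperplane of [A1] and none of
    [A0].

    Given coordinates [f] for [A0], the coordinates for [A] are [v] and the
    [g + c v] for [g] in [f].  Since [v] vanishes on [Span A0], the latter have
    the old values on [A0]; with [c] large they are nonnegative on [A1].  The
    normals of [A1] are then rescaled.  If they are all very short, the
    coordinates [g + c v] still determine how the parts in [A0] of two
    separating sets compare ([embeds_gap]).  It remains to compare the parts in
    [A1], by means of the coordinate [v].  For this the weights [<v, nu H>]
    are made to decrease so fast along the ray from [p] that every one of them
    exceeds the sum of all those that come later on the ray.

    Here is why this is enough ([step_embeds]).  Let [S x] and [S y] meet [A0]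
    in comparable sets, the first one being the smaller, and let [a] in [A1]
    lie in [S x] but not in [S y].  If [b] in [A1] lies in [S y] but not in
    [S x], then [b] comes after [a] on the ray: let [H] in [A0] contain the
    intersection of [a] and [b].  The normals of [a] and [b], normalised by
    [<v, _> = 1], differ by a multiple of the normal of [H], so which of the
    two is crossed first along a line parallel to [v] depends only on the side
    of [H].  If [b] came first at [p], then [H] would have to separate [x] from
    [p], because [x] is past [a] but not past [b]; so [H] would separate [y]
    from [p] as well, and [y], being past [b], would be past [a]
    ([A1_inversion]).  Hence the weight of [a] exceeds the total weight of the
    part of [S y] outside [S x], and the coordinate [v] is larger at [x] than
    at [y].

    Ranks 1 and 2 are instances of the same step: a single hyperplane is split
    off the empty arrangement, and in rank 2 the part [A0] consists of one of
    the two walls of the base region. *)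

(** * Orthogonality and hyperplanes *)

Section InnerProduct.
Variables (R : realType) (n : nat).
Local Notation E := 'rV[R]_n.
Implicit Types (u v w x y z : E) (U H : {vspace E}).

Lemma dotvC u v : dotv u v = dotv v u.
Proof. by apply: eq_bigr => i _; rewrite mulrC. Qed.

Lemma dotvDr u v w : dotv u (v + w) = dotv u v + dotv u w.
Proof. exact: (raddfD (dotv u : {linear E -> R^o})). Qed.

Lemma dotvZr u a v : dotv u (a *: v) = a * dotv u v.
Proof. exact: (linearZ_LR (dotv u : {linear E -> R^o})). Qed.

Lemma dotvNr u v : dotv u (- v) = - dotv u v.
Proof. exact: (raddfN (dotv u : {linear E -> R^o})). Qed.

Lemma dotv0r u : dotv u 0 = 0.
Proof. exact: (raddf0 (dotv u : {linear E -> R^o})). Qed.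

Lemma dotv_sumr u I (r : seq I) (P : pred I) (F : I -> E) :
  dotv u (\sum_(i <- r | P i) F i) = \sum_(i <- r | P i) dotv u (F i).
Proof. exact: (raddf_sum (dotv u : {linear E -> R^o})). Qed.

Lemma dotvDl u v w : dotv (u + v) w = dotv u w + dotv v w.
Proof. by rewrite !(dotvC _ w) dotvDr. Qed.

Lemma dotvZl a u v : dotv (a *: u) v = a * dotv u v.
Proof. by rewrite !(dotvC _ v) dotvZr. Qed.

Lemma dotvNl u v : dotv (- u) v = - dotv u v.
Proof. by rewrite !(dotvC _ v) dotvNr. Qed.

Lemma dotv0l u : dotv 0 u = 0.
Proof. by rewrite dotvC dotv0r. Qed.

Definition dotvE :=
  (dotvDr, dotvZr, dotvNr, dotv0r, dotvDl, dotvZl, dotvNl, dotv0l).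

Lemma dotvv_gt0 u : u != 0 -> 0 < dotv u u.
Proof.
move=> u0; have ge0 i : true -> 0 <= u 0 i * u 0 i by rewrite -expr2 sqr_ge0.
rewrite lt_neqAle sumr_ge0 // andbT eq_sym; apply: contraNN u0 => /eqP uu0.
apply/eqP/rowP => i; rewrite mxE; apply/eqP; rewrite -sqrf_eq0 expr2.
by apply/eqP; exact: (psumr_eq0P ge0 uu0).
Qed.

Lemma dotvv_eq0 u : dotv u u = 0 -> u = 0.
Proof.
by move=> uu0; apply/eqP; apply: contraT => /dotvv_gt0; rewrite uu0 ltxx.
Qed.

Definition pairing k (f : k.-tuple E) : 'M[R]_(n, k) :=
  \matrix_(j, i) (tnth f i) 0 j.

Lemma pairingE k (f : k.-tuple E) z i :
  linfun (mulmxr (pairing f)) z 0 i = dotv (tnth f i) z.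
Proof. by rewrite lfunE /= mxE; apply: eq_bigr => j _; rewrite mxE mulrC. Qed.

(** Rank-nullity for the pairing with a basis of [U], whose kernel is
    [orthv U]. *)
Lemma dim_orthv_ge U : (n <= \dim U + \dim (orthv U))%N.
Proof.
pose L : 'Hom(E, 'rV[R]_(\dim U)) := linfun (mulmxr (pairing (vbasis U))).
have kerL : (lker L <= orthv U)%VS.
  apply/subvP => z; rewrite memv_ker => /eqP /rowP Lz0.
  apply/orthvP => u uU; rewrite dotvC (coord_vbasis uU) dotv_sumr.
  apply: big1 => i _; rewrite dotvZr dotvC -tnth_nth -pairingE Lz0.
  by rewrite mxE mulr0.
have := limg_ker_dim L fullv; rewrite capfv dimvf /dim /= mul1n => En.
rewrite -[leqLHS]En addnC leq_add ?dimvS //.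
by apply: leq_trans (dimvS (subvf _)) _; rewrite dimvf /dim /= mul1n.
Qed.

Lemma orthv_cap U : (U :&: orthv U = 0)%VS.
Proof.
apply/eqP; rewrite -subv0; apply/subvP => u.
rewrite memv_cap memv0 => /andP[uU /orthvP uo].
by apply/eqP/dotvv_eq0/uo.
Qed.

Lemma orthv_decomp U z : exists u w, [/\ u \in U, w \in orthv U & z = u + w].
Proof.
have UE : (U + orthv U)%VS = fullv.
  apply/eqP; rewrite eqEdim subvf dimvf /dim /= mul1n dimv_disjoint_sum
    ?orthv_cap //; exact: dim_orthv_ge.
have : z \in (U + orthv U)%VS by rewrite UE memvf.
by case/memv_addP => u uU [w wU ->]; exists u, w.
Qed.

Section Hyperplane.
Variables (H : {vspace E}) (nH : E).
Hypotheses (dimH : (\dim H).+1 = n) (normH : is_normal H nH).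

Lemma orthv_vline : orthv H = <[nH]>%VS.
Proof.
case: normH => nH0 nHo.
apply/esym/eqP; rewrite eqEdim -memvE nHo dim_vline nH0 /=.
have := dimvS (subvf (H + orthv H)%VS).
rewrite dimv_disjoint_sum ?orthv_cap // dimvf /dim /= mul1n.
by move=> le_n; rewrite -(leq_add2l (\dim H)) addn1 dimH.
Qed.

Lemma orthv_line u : u \in orthv H -> exists a, u = a *: nH.
Proof. by rewrite orthv_vline => /vlineP. Qed.

Lemma mem_hyperplane z : (z \in H) = (dotv z nH == 0).
Proof.
case: (normH) => nH0 /orthvP nHo.
apply/idP/eqP => [/nHo //|].
have [u [w [uH /orthv_line[a ->] ->]]] := orthv_decomp H z.
rewrite dotvDl nHo // add0r dotvZl => /eqP.
rewrite mulf_eq0 (gt_eqF (dotvv_gt0 nH0)) orbF => /eqP ->.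
by rewrite scale0r addr0.
Qed.

End Hyperplane.

Lemma normal_exists H : (\dim H).+1 = n -> exists v, is_normal H v.
Proof.
move=> dimH; exists (vpick (orthv H)); split; last exact: memv_pick.
rewrite vpick0 -dimv_eq0 -lt0n -(ltn_add2l (\dim H)) addn0.
by apply: leq_trans (dim_orthv_ge H); rewrite dimH.
Qed.

Lemma is_normalZ H v a : a != 0 -> is_normal H v -> is_normal H (a *: v).
Proof.
by move=> a0 [v0 vo]; split; [rewrite scaler_eq0 negb_or a0 | exact: rpredZ].
Qed.

Lemma hyperplane_inj H1 H2 v : (\dim H1).+1 = n -> (\dim H2).+1 = n ->
  is_normal H1 v -> is_normal H2 v -> H1 = H2.
Proof.
move=> d1 d2 n1 n2; apply/vspaceP => z.
by rewrite (mem_hyperplane d1 n1) (mem_hyperplane d2 n2).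
Qed.

(** The component [w] of [v] orthogonal to [v1] and [v2] lies in
    [H1 :&: H2], hence in [H], so that it is orthogonal to [v] too. *)
Lemma normal_pencil H1 H2 H v1 v2 v :
    (\dim H1).+1 = n -> (\dim H2).+1 = n -> (\dim H).+1 = n ->
    is_normal H1 v1 -> is_normal H2 v2 -> is_normal H v ->
  (H1 :&: H2 <= H)%VS -> exists a b, v = a *: v1 + b *: v2.
Proof.
move=> d1 d2 d n1 n2 nH /subvP sub.
have [u [w [/memv_addP[_ /vlineP[a ->] [_ /vlineP[b ->] ->]]] wo vE]] :=
  orthv_decomp (<[v1]> + <[v2]>)%VS v.
exists a, b; rewrite vE; suff -> : w = 0 by rewrite addr0.
move: wo => /orthvP wo.
have w1 : dotv w v1 = 0.
  by rewrite dotvC wo // (subvP (addvSl _ _)) ?memv_line.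
have w2 : dotv w v2 = 0.
  by rewrite dotvC wo // (subvP (addvSr _ _)) ?memv_line.
have: w \in H.
  rewrite sub // memv_cap (mem_hyperplane d1 n1) (mem_hyperplane d2 n2).
  by rewrite w1 w2 eqxx.
rewrite (mem_hyperplane d nH) vE !dotvE w1 w2 !mulr0 !add0r => /eqP.
exact: dotvv_eq0.
Qed.

(** The dual basis: [b] consists of the preimages in [U] of the unit vectors
    under the pairing with [f]. *)
Lemma dual_basis d (U : {vspace E}) (f : d.-tuple E) :
    \dim U = d ->
    (forall z, z \in U -> (forall g, g \in f -> dotv g z = 0) -> z = 0) ->
  exists b : d.-tuple E, basis_of U b /\
    forall z i, z \in U -> coord b i z = dotv (tnth f i) z.
Proof.
move=> dimU injf; pose L : 'Hom(E, 'rV[R]_d) := linfun (mulmxr (pairing f)).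
have kerL : (U :&: lker L = 0)%VS.
  apply/eqP; rewrite -subv0; apply/subvP => z.
  rewrite memv_cap memv0 memv_ker => /andP[zU /eqP/rowP Lz0].
  apply/eqP/injf => // g /tnthP[i ->]; rewrite -pairingE.
  by rewrite Lz0 mxE.
have imL : (L @: U)%VS = fullv.
  apply/eqP; rewrite eqEdim subvf dimvf /dim /= mul1n.
  by have := limg_ker_dim L U; rewrite kerL dimv0 add0n dimU => ->.
have ex_b i : exists z, z \in U /\ L z = delta_mx 0 i.
  have : delta_mx 0 i \in (L @: U)%VS by rewrite imL memvf.
  by case/memv_imgP => z zU ->; exists z.
have [b0 b0P] := choice ex_b.
pose b := [tuple b0 i | i < d].
have bE (i : 'I_d) : b`_i = b0 i by rewrite -tnth_nth tnth_mktuple.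
have dual (c : 'I_d -> R) i : dotv (tnth f i) (\sum_j c j *: b`_j) = c i.
  rewrite dotv_sumr (bigD1 i) //= big1 => [|j ji].
    by rewrite dotvZr -pairingE bE (b0P i).2 mxE !eqxx mulr1 addr0.
  by rewrite dotvZr -pairingE bE (b0P j).2 mxE eq_sym (negPf ji) mulr0.
have bU : basis_of U b.
  rewrite basisEfree size_tuple dimU leqnn andbT; apply/andP; split.
    by apply/freeP => c c0 i; rewrite -(dual c) c0 dotv0r.
  by apply/span_subvP => _ /mapP[i _ ->]; exact: (b0P i).1.
exists b; split => // z i zU.
by rewrite [in RHS](coord_basis bU zU) dual.
Qed.

End InnerProduct.

(** * Regions as sign cones *)

Section Chambers.
Variables (R : realType) (n : nat).
Local Notation E := 'rV[R]_n.
Implicit Types (A : {fset {vspace E}}) (H : {vspace E}) (u v w x y z : E).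

Definition hyperplanes A := forall H, H \in A -> (\dim H).+1 = n.

Lemma dotv_continuous v : continuous (fun u : E => dotv u v).
Proof.
rewrite /dotv; elim: (index_enum _) => [|i s IHs] u.
  rewrite [X in continuous_at _ X](_ : _ = cst 0); last first.
    by apply/funext => w; rewrite big_nil.
  exact: cst_continuous.
rewrite [X in continuous_at _ X](_ : _ =
    (fun w : E => w 0 i * v 0 i + \sum_(j <- s) w 0 j * v 0 j)); last first.
  by apply/funext => w; rewrite big_cons.
apply: (@continuousD R R E (fun w : E => w 0 i * v 0 i)
    (fun w : E => \sum_(j <- s) w 0 j * v 0 j)); last exact: IHs.
apply: (@continuousM R E (fun w : E => w 0 i) (cst (v 0 i))).
  exact: coord_continuous.
exact: cst_continuous.
Qed.

Lemma side_continuous x v : continuous (fun u : E => dotv x v * dotv u v).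
Proof.
move=> u; apply: (@continuousM R E (cst (dotv x v)) (fun u : E => dotv u v)).
  exact: cst_continuous.
exact: dotv_continuous.
Qed.

Lemma line_continuous x w : continuous (fun t : R => x + t *: w).
Proof.
by move=> t; apply: cvgD; [exact: cvg_cst | apply: cvgZr_tmp; exact: cvg_id].
Qed.

(** The normal occurs in both factors, so neither its length nor its
    direction matters. *)
Definition chamber A x : set E :=
  [set y | forall H v, H \in A -> is_normal H v -> 0 < dotv x v * dotv y v].

Lemma complementP A x H v : hyperplanes A -> complement A x -> H \in A ->
  is_normal H v -> dotv x v != 0.
Proof.
by move=> hA cx HA nv; rewrite -(mem_hyperplane (hA _ HA) nv); apply: cx.
Qed.

Lemma chamber_complement A x y :
  hyperplanes A -> chamber A x y -> complement A y.
Proof.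
move=> hA cxy H HA; have [v nv] := normal_exists (hA _ HA).
rewrite (mem_hyperplane (hA _ HA) nv); apply: contraTneq (cxy _ _ HA nv) => ->.
by rewrite mulr0 ltxx.
Qed.

(** A connected subset of the complement stays on one side of every
    hyperplane by the intermediate value theorem; conversely the segment from
    [x] to a point of its chamber does not leave the chamber. *)
Lemma component_chamber A x : hyperplanes A -> complement A x ->
  connected_component (complement A) x = chamber A x.
Proof.
move=> hA cx; apply/seteqP; split => y.
  move=> cxy H v HA nv; have x0 := complementP hA cx HA nv.
  have cy := connected_component_sub cxy.
  have y0 := complementP hA cy HA nv.
  pose I := (fun u => dotv u v) @` connected_component (complement A) x.
  have : connected I.
    apply: connected_continuous_connected; first exact: component_connected.
    by apply: continuous_subspaceT => u; exact: dotv_continuous.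
  move=> /connected_intervalP itv; rewrite ltNge; apply/negP => le0.
  have [z cxz z0] : I 0.
    have hx : I (dotv x v) by exists x => //; exact: connected_component_refl.
    have hy : I (dotv y v) by exists y.
    have [x_le|x_gt] := leP (dotv x v) 0.
      apply: (itv _ _ hx hy); rewrite x_le /=.
      have x_lt : dotv x v < 0 by rewrite lt_neqAle x0.
      by rewrite -(nmulr_rle0 (dotv y v) x_lt).
    apply: (itv _ _ hy hx); rewrite (ltW x_gt) andbT.
    by rewrite -(pmulr_rle0 (dotv y v) x_gt).
  have := connected_component_sub cxz _ HA.
  by rewrite (mem_hyperplane (hA _ HA) nv) z0 eqxx.
move=> cxy; pose S := (fun t : R => x + t *: (y - x)) @` `[0, 1]%classic.
have Sy : S y.
  by exists 1 => /=; rewrite ?in_itv/= ?ler01 ?lexx // scale1r subrKC.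
suff : S `<=` connected_component (complement A) x by apply.
apply: connected_component_max.
- by exists 0 => /=; rewrite ?in_itv/= ?ler01 ?lexx // scale0r addr0.
- move=> _ [t /= t01 <-]; move: t01; rewrite in_itv /= => /andP[t0 t1].
  apply: (@chamber_complement _ x) => // H v HA nv.
  have xy := cxy _ _ HA nv; have x0 := complementP hA cx HA nv.
  have xx : 0 < dotv x v * dotv x v by rewrite -expr2 exprn_even_gt0.
  rewrite !dotvE.
  have -> : dotv x v * (dotv x v + t * (dotv y v - dotv x v)) =
    (1 - t) * (dotv x v * dotv x v) + t * (dotv x v * dotv y v) by ring.
  have [->|t_neq0] := eqVneq t 0; first by rewrite subr0 mul1r mul0r addr0.
  apply: ltr_wpDl; first by rewrite mulr_ge0 ?subr_ge0 ?(ltW xx).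
  by apply: mulr_gt0 xy; rewrite lt_neqAle eq_sym t_neq0.
- apply: connected_continuous_connected; first exact: segment_connected.
  by apply: continuous_subspaceT => u; exact: line_continuous.
Qed.

Lemma near_seq (T : eqType) (s : seq T) (F : set_system E)
    (P : T -> E -> Prop) :
    Filter F -> (forall t, t \in s -> \forall z \near F, P t z) ->
  \forall z \near F, forall t, t \in s -> P t z.
Proof.
move=> FF; elim: s => [|a s IHs] hs; first exact: nearW.
near=> z => t; rewrite inE => /predU1P[->|ts].
  by near: z; apply: hs; rewrite mem_head.
by move: t ts; near: z; apply: IHs => t ts; apply: hs; rewrite inE ts orbT.
Unshelve. all: by end_near. Qed.

Lemma open_chamber A x : hyperplanes A -> open (chamber A x).
Proof.
move=> hA; rewrite openE => y cxy; rewrite /interior.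
suff : \forall z \near y, forall H, H \in enum_fset A ->
    forall v, is_normal H v -> 0 < dotv x v * dotv z v.
  by apply: filterS => z hz H v HA; apply: hz.
apply: (@near_seq _ _ (nbhs y)
  (fun H z => forall v, is_normal H v -> 0 < dotv x v * dotv z v)) => H HA.
have [v nv] := normal_exists (hA _ HA).
have : \forall z \near y, 0 < dotv x v * dotv z v.
  apply: (@side_continuous x v y [set r | 0 < r]).
  by apply: open_nbhs_nbhs; split; [exact: open_gt | exact: (cxy _ _ HA nv)].
apply: filterS => z pos w nw.
have [a wE] := orthv_line (hA _ HA) nv nw.2.
have a0 : a != 0 by apply: contraTneq nw.1 => a0; rewrite wE a0 scale0r eqxx.
rewrite wE !dotvZr mulrACA mulr_gt0 // -expr2 exprn_even_gt0 //=.
Qed.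

(** A point of the closure lies weakly on the side of [x] of every
    hyperplane. If it is interior to the closure, it can still be moved away
    from that side, so it cannot lie on the hyperplane. *)
Lemma interior_closure_chamber A x : hyperplanes A -> complement A x ->
  interior (closure (chamber A x)) = chamber A x.
Proof.
move=> hA cx; apply/seteqP; split => y; last first.
  move=> cxy; apply: filterS (@subset_closure _ _) _.
  exact: (open_nbhs_nbhs (conj (open_chamber hA) cxy)).
move=> icy H v HA nv; have x0 := complementP hA cx HA nv.
have weak z : closure (chamber A x) z -> 0 <= dotv x v * dotv z v.
  pose D := (fun z => dotv x v * dotv z v) @^-1` [set r | 0 <= r].
  suff : closure (chamber A x) `<=` D by apply.
  have cD : closed D.
    apply: preimage_closed; last exact: closed_ge.
    by move=> u _; exact: side_continuous.
  rewrite [X in _ `<=` X](iffLR (closure_id D) cD).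
  by apply: closure_subset => u /(_ H v HA nv) /ltW.
(* Moving along this vector decreases the product of the two sides. *)
pose w := - dotv x v *: v.
have nearc : \forall t \near (0 : R), closure (chamber A x) (y + t *: w).
  have := @line_continuous y w 0; rewrite /continuous_at scale0r addr0.
  by apply.
have [e /= e0 he] := nearc.
have ce : closure (chamber A x) (y + (e / 2) *: w).
  apply: he; rewrite /= sub0r normrN gtr0_norm; lra.
have := weak _ ce; rewrite /w !dotvE.
have -> : dotv x v * (dotv y v + e / 2 * (- dotv x v * dotv v v)) =
  dotv x v * dotv y v - e / 2 * ((dotv x v) ^+ 2 * dotv v v) by ring.
rewrite subr_ge0; apply: lt_le_trans; apply: mulr_gt0; first lra.
by apply: mulr_gt0; [rewrite exprn_even_gt0 | exact: dotvv_gt0 nv.1].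
Qed.

Lemma region_chamber A Q : hyperplanes A -> region A Q ->
  exists2 x, complement A x & Q = closure (chamber A x).
Proof.
by move=> hA [x cx ->]; exists x => //; rewrite component_chamber.
Qed.

Lemma chamber_region A x : hyperplanes A -> complement A x ->
  region A (closure (chamber A x)).
Proof. by move=> hA cx; exists x => //; rewrite component_chamber. Qed.

Lemma chamber_refl A x : hyperplanes A -> complement A x -> chamber A x x.
Proof.
move=> hA cx H v HA nv.
by rewrite -expr2 exprn_even_gt0 //= (complementP hA cx HA nv).
Qed.

Lemma chamber_gt0 A x y H v : chamber A x y -> H \in A -> is_normal H v ->
  (0 < dotv y v) = (0 < dotv x v).
Proof.
move=> cxy HA nv; have := cxy _ _ HA nv.
have [x0|x0|<-] := ltgtP 0 (dotv x v); last by rewrite mul0r ltxx.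
  by rewrite pmulr_rgt0.
by rewrite nmulr_rgt0 // => /ltW; rewrite leNgt => /negPf.
Qed.

Lemma chamber_lt0 A x y H v : chamber A x y -> H \in A -> is_normal H v ->
  (dotv y v < 0) = (dotv x v < 0).
Proof.
move=> cxy HA nv.
have nN : is_normal H (- v).
  by rewrite -scaleN1r; apply: is_normalZ; rewrite ?oppr_eq0 ?oner_eq0.
by have := chamber_gt0 cxy HA nN; rewrite !dotvNr !oppr_gt0.
Qed.

Lemma chamber_trans A0 A x y : (A0 `<=` A)%fset -> chamber A0 x y ->
  chamber A y `<=` chamber A0 x.
Proof.
move=> /fsubsetP sub cxy z cyz H u HA nu.
have := cxy _ _ HA nu; have := cyz _ _ (sub _ HA) nu.
have [y0|y0|y0] := ltgtP 0 (dotv y u); last by rewrite -y0 mul0r ltxx.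
  by rewrite (pmulr_rgt0 _ y0) (pmulr_lgt0 _ y0) => z0 x0; exact: mulr_gt0.
by rewrite (nmulr_rgt0 _ y0) (nmulr_lgt0 _ y0) => z0 x0; rewrite nmulr_rgt0.
Qed.

Lemma chamber_sym A x y : chamber A x y -> chamber A y x.
Proof. by move=> cxy H u HA nu; rewrite mulrC; exact: cxy HA nu. Qed.

Lemma directed_normal A p H : hyperplanes A -> complement A p -> H \in A ->
  exists u, is_normal H u /\ dotv p u < 0.
Proof.
move=> hA cp HA; have [u nu] := normal_exists (hA _ HA).
have := complementP hA cp HA nu; rewrite neq_lt => /orP[pu|pu].
  by exists u.
exists (- u); rewrite dotvNr oppr_lt0; split => //.
by rewrite -scaleN1r; apply: is_normalZ; rewrite ?oppr_eq0 ?oner_eq0.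
Qed.

Lemma complementS A A0 x :
  (A0 `<=` A)%fset -> complement A x -> complement A0 x.
Proof. by move=> /fsubsetP sA cx H HA; apply/cx/sA. Qed.

Lemma mem_sepset A p q H v :
    hyperplanes A -> complement A p -> complement A q ->
    H \in A -> is_normal H v -> dotv p v < 0 ->
  (H \in sepset A (closure (chamber A p)) (closure (chamber A q))) =
    (0 < dotv q v).
Proof.
move=> hA cp cq HA nv pv; rewrite /sepset !inE HA /=.
apply/asboolP/idP => [[w [nw qw pw]] | qv]; last first.
  exists v; split => // x; rewrite interior_closure_chamber // => cx.
    by rewrite (chamber_gt0 cx HA nv).
  by rewrite (chamber_lt0 cx HA nv).
have := qw q; rewrite interior_closure_chamber // => /(_ (chamber_refl hA cq)).
have := pw p; rewrite interior_closure_chamber // => /(_ (chamber_refl hA cp)).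
have [a ->] := orthv_line (hA _ HA) nv nw.2.
by rewrite !dotvZr nmulr_llt0 // => a0; rewrite pmulr_rgt0.
Qed.

End Chambers.

(** * Finite families of reals *)

Section FiniteReals.
Variable R : realType.

Lemma seq_upper_bound (s : seq R) :
  exists2 M, 0 < M & forall r, r \in s -> r <= M.
Proof.
elim: s => [|a s [M M0 hM]]; first by exists 1; rewrite ?ltr01.
exists (Num.max a M); first by rewrite lt_max M0 orbT.
by move=> r /predU1P[->|/hM rM]; rewrite le_max ?lexx // rM orbT.
Qed.

Lemma seq_positive_gap (s : seq R) :
  exists2 d, 0 < d & forall r, r \in s -> r <= d -> r <= 0.
Proof.
elim: s => [|a s [d d0 hd]]; first by exists 1; rewrite ?ltr01.
have [a_le|a_gt] := leP a 0.
  by exists d => // r /predU1P[->|/hd].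
exists (Num.min (a / 2) d) => [|r /predU1P[->|/hd rd]].
- by rewrite lt_min d0 andbT; lra.
- by rewrite le_min => /andP[]; lra.
- by rewrite le_min => /andP[_ /rd].
Qed.

Lemma sum_subpred (T : eqType) (s : seq T) (P Q : pred T) (w : T -> R) :
    {in s, forall c, 0 <= w c} -> {in s, forall c, P c -> Q c} ->
  \sum_(c <- s | P c) w c <= \sum_(c <- s | Q c) w c.
Proof.
move=> w0 PQ; rewrite [leLHS]big_mkcond [leRHS]big_mkcond /=.
rewrite [leLHS]big_seq [leRHS]big_seq.
apply: ler_sum => c cs; have := PQ c cs.
by case: (P c) => [->|_] //; case: ifP => // _; exact: w0.
Qed.

Lemma seq_argmax (T : eqType) (s : seq T) (k : T -> R) a : a \in s ->
  exists2 m, m \in s & forall b, b \in s -> k b <= k m.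
Proof.
elim: s a => // c [|d s] IHs a as_.
  by exists c; rewrite ?mem_head // => b /[1!inE] /eqP ->.
have [m ms hm] := IHs d (mem_head _ _).
have [cm|mc] := leP (k c) (k m).
  by exists m => [|b /predU1P[->|/hm]] //; rewrite inE ms orbT.
exists c => [|b /predU1P[->|/hm bm]] //; first exact: mem_head.
exact: le_trans bm (ltW mc).
Qed.

(** The weights are powers of [size s + 1], the exponent of [a] being the
    number of the entries of [s] below [a]: each entry below [a] weighs at most
    [w a / (size s + 1)]. *)
Lemma dominating_weights (T : eqType) (s : seq T) (k : T -> R) :
  exists w : T -> R, (forall a, 0 < w a) /\
    forall a, \sum_(c <- s | k c < k a) w c < w a.
Proof.
pose rk a := count (fun c => k c < k a) s.
pose b : R := (size s).+1%:R; have b0 : 0 < b by rewrite ltr0Sn.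
exists (fun a => b ^+ rk a); split => a; first exact: exprn_gt0.
rewrite -(ltr_pM2r b0) mulr_suml.
have le_w c : c \in s -> k c < k a -> b ^+ rk c * b <= b ^+ rk a.
  move=> cs kca; rewrite -exprSr ler_weXn2l ?ler1n // -addn1.
  have c_gt0 : (0 < count (pred1 c) s)%N by rewrite -has_count has_pred1.
  apply: leq_trans (_ : rk c + count (pred1 c) s <= _)%N.
    by rewrite leq_add2l.
  rewrite -count_predUI (@eq_count _ (predI _ _) pred0) => [|d /=]; last first.
    by apply/negP => /andP[+ /eqP dc]; rewrite dc ltxx.
  rewrite count_pred0 addn0; apply: sub_count => d /= /orP[/lt_trans|/eqP->] //.
  exact.
apply: (@le_lt_trans _ _ (\sum_(c <- s) b ^+ rk a)).
  rewrite big_mkcond big_seq [leRHS]big_seq; apply: ler_sum => c cs.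
  by case: ifP => [/le_w|_]; [exact | rewrite exprn_ge0 // ltW].
rewrite big_const_seq count_predT iter_addr_0 -[ltLHS]mulr_natr.
by rewrite ltr_pM2l ?exprn_gt0 // ltr_nat.
Qed.

End FiniteReals.

(** * Coordinates for separating sets *)

Section Embeddings.
Variables (R : realType) (n : nat).
Local Notation E := 'rV[R]_n.
Implicit Types (A : {fset {vspace E}}) (H : {vspace E}) (g p u v x y z : E).

Definition positive_sum A (nu : {vspace E} -> E) x : E :=
  \sum_(H <- enum_fset A | 0 < dotv x (nu H)) nu H.

(** [nu] and [f] are the data of a zonotopal embedding, [f] being the list of
    the coordinate functionals.  The second clause makes the coordinates
    monotone in the separating set; the fourth one is the converse. *)
Definition embeds A p (nu : {vspace E} -> E) (f : seq E) : Prop :=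
  [/\ forall H, H \in A -> is_normal H (nu H) /\ dotv p (nu H) < 0,
      forall g H, g \in f -> H \in A -> 0 <= dotv g (nu H),
      forall z, z \in Span A -> (forall g, g \in f -> dotv g z = 0) -> z = 0
    & forall x y, complement A x -> complement A y ->
      (forall g, g \in f ->
         dotv g (positive_sum A nu x) <= dotv g (positive_sum A nu y)) ->
      forall H, H \in A -> 0 < dotv x (nu H) -> 0 < dotv y (nu H)].

Definition embeddable A p := exists nu f, size f = rank A /\ embeds A p nu f.

Lemma orthv_Span A H : H \in A -> (orthv H <= Span A)%VS.
Proof. by move=> HA; rewrite /Span (big_rem H) //= addvSl. Qed.

Lemma Span_sub A (U : {vspace E}) :
  (forall H, H \in A -> (orthv H <= U)%VS) -> (Span A <= U)%VS.
Proof.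
move=> AU; rewrite /Span big_seq; apply: (big_ind (fun V => (V <= U)%VS)) => //.
  exact: sub0v.
by move=> V W VU WU; rewrite subv_add VU.
Qed.

Lemma Span_perp A v : (forall H u, H \in A -> u \in orthv H -> dotv v u = 0) ->
  forall z, z \in Span A -> dotv v z = 0.
Proof.
move=> vA z zA; suff : z \in lker (linfun (dotv v : E -> R^o)).
  by rewrite memv_ker lfunE => /eqP.
apply: subvP zA; apply: Span_sub => H HA; apply/subvP => u uH.
by rewrite memv_ker lfunE /= (vA H).
Qed.

Lemma big_fsetU_disjoint (V : nmodType) A0 A1 (P : pred {vspace E})
    (F : {vspace E} -> V) :
    [disjoint A0 & A1]%fset ->
  \sum_(H <- enum_fset (A0 `|` A1)%fset | P H) F H =
  \sum_(H <- enum_fset A0 | P H) F H + \sum_(H <- enum_fset A1 | P H) F H.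
Proof.
move=> /fdisjointP dis; rewrite -big_cat; apply: perm_big.
apply: uniq_perm; rewrite ?fset_uniq ?cat_uniq ?fset_uniq ?andbT //=.
  by apply/hasPn => H HA1; apply: contraL HA1 => /dis.
by move=> H; rewrite mem_cat in_fsetU.
Qed.

(** There are only finitely many separating sets, so the coordinates of their
    sums differ by more than some [d] as soon as they are not in order. *)
Lemma embeds_gap A p nu f : embeds A p nu f ->
  exists2 d : R, 0 < d & forall x y, complement A x -> complement A y ->
    (forall g, g \in f ->
       dotv g (positive_sum A nu x) <= dotv g (positive_sum A nu y) + d) ->
    forall H, H \in A -> 0 < dotv x (nu H) -> 0 < dotv y (nu H).
Proof.
case=> _ _ _ ord.
pose Zs := [seq \sum_(H <- enum_fset W) nu H |
  W : {fset {vspace E}} <- enum_fset (fpowerset A)].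
have ZsP x : positive_sum A nu x \in Zs.
  apply/mapP; exists [fset H in A | 0 < dotv x (nu H)]%fset.
    by rewrite fpowersetE; apply: fset_sub.
  by rewrite big_fset.
have [d d0 hd] := seq_positive_gap
  [seq dotv g c | g <- f, c <- [seq a - b | a <- Zs, b <- Zs]].
exists d => // x y cx cy le_d; apply: ord => // g gf.
rewrite -subr_le0 -dotvNr -dotvDr; apply: hd.
  by apply: allpairs_f => //; apply: allpairs_f.
by rewrite dotvDr dotvNr lerBlDl le_d.
Qed.

(** * Adjoining the second part of a splitting *)

Section Step.
Variables (A A0 A1 : {fset {vspace E}}) (p v : E).
Hypotheses (hA : hyperplanes A) (AE : A = (A0 `|` A1)%fset).
Hypotheses (dis : [disjoint A0 & A1]%fset) (A1n0 : exists H, H \in A1).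
Hypothesis rkA : rank A = (rank A0).+1.
Hypothesis v_A0 : forall H u, H \in A0 -> u \in orthv H -> dotv v u = 0.
Hypothesis v_A1 : forall H, H \in A1 ->
  exists u, [/\ is_normal H u, dotv p u < 0 & 0 < dotv v u].
Hypothesis modA : forall H1 H2, H1 \in A1 -> H2 \in A1 -> H1 <> H2 ->
  exists2 H, H \in A0 & (H1 :&: H2 <= H)%VS.

Let A0sub : (A0 `<=` A)%fset. Proof. by rewrite AE fsubsetUl. Qed.
Let A1A H : H \in A1 -> H \in A. Proof. by rewrite AE in_fsetU orbC => ->. Qed.
Let A0A H : H \in A0 -> H \in A. Proof. by rewrite AE in_fsetU => ->. Qed.

Lemma normalized_normals : exists n1 : {vspace E} -> E, forall H, H \in A1 ->
  [/\ is_normal H (n1 H), dotv p (n1 H) < 0 & dotv v (n1 H) = 1].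
Proof.
have ex_u H : exists u, H \in A1 ->
    [/\ is_normal H u, dotv p u < 0 & dotv v u = 1].
  have [HA1|_] := boolP (H \in A1); last by exists 0.
  have [u [nu pu vu]] := v_A1 HA1.
  exists ((dotv v u)^-1 *: u) => _; split.
  - by apply: is_normalZ; rewrite ?invr_eq0 ?gt_eqF.
  - by rewrite dotvZr pmulr_rlt0 // invr_gt0.
  - by rewrite dotvZr mulVf // gt_eqF.
by have [n1 hn1] := choice ex_u; exists n1.
Qed.

Section Order.
Variables (nu0 n1 : {vspace E} -> E).
Hypothesis hn0 : forall H, H \in A0 ->
  is_normal H (nu0 H) /\ dotv p (nu0 H) < 0.
Hypothesis hn1 : forall H, H \in A1 ->
  [/\ is_normal H (n1 H), dotv p (n1 H) < 0 & dotv v (n1 H) = 1].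

(** The normal of the hyperplane [H] of [A0] in the pencil of [a] and [b] is
    orthogonal to [v], so its coefficients on [n1 a] and [n1 b] are
    opposite. *)
Lemma A1_normal_diff a b : a \in A1 -> b \in A1 -> a <> b ->
  exists H c, [/\ H \in A0, c != 0 & n1 b - n1 a = c *: nu0 H].
Proof.
move=> aA bA ab; have [H HA0 sub] := modA aA bA ab.
have [na _ va] := hn1 aA; have [nb _ vb] := hn1 bA; have [nH _] := hn0 HA0.
have [s [t E1]] :=
  normal_pencil (hA (A1A aA)) (hA (A1A bA)) (hA (A0A HA0)) na nb nH sub.
have := v_A0 HA0 nH.2; rewrite E1 !dotvE va vb !mulr1 => /eqP.
rewrite addr_eq0 => /eqP st.
have nuE : nu0 H = t *: (n1 b - n1 a) by rewrite E1 st scaleNr scalerBr addrC.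
have t0 : t != 0.
  by apply: contraTneq nH.1 => t0; rewrite nuE t0 scale0r eqxx.
by exists H, t^-1; split; rewrite ?invr_eq0 // nuE scalerA mulVf // scale1r.
Qed.

(** [- dotv p (n1 a)] is the time at which the ray from [p] in the direction
    [v] crosses [a]; this ray never meets the hyperplane of [A0] in the pencil
    of [a] and [b], so it does not cross both at once. *)
Lemma A1_heights_distinct a b : a \in A1 -> b \in A1 -> a <> b ->
  dotv p (n1 a) != dotv p (n1 b).
Proof.
move=> aA bA ab; have [H [c [HA0 c0 E1]]] := A1_normal_diff aA bA ab.
rewrite eq_sym -subr_eq0 -dotvNr -dotvDr E1 dotvZr mulf_neq0 //.
by rewrite lt_eqF //; exact: (hn0 HA0).2.
Qed.

(** If [b] precedes [a] on the ray from [p], while [x] is past [a] but not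
    past [b], then the hyperplane of [A0] in the pencil of [a] and [b] separates
    [x] from [p], hence also [y] from [p], so that [a] precedes [b] on the line
    through [y]. *)
Lemma A1_inversion a b x y : a \in A1 -> b \in A1 ->
    (forall H, H \in A0 -> 0 < dotv x (nu0 H) -> 0 < dotv y (nu0 H)) ->
    dotv p (n1 a) < dotv p (n1 b) ->
    0 < dotv x (n1 a) -> ~~ (0 < dotv x (n1 b)) ->
  0 < dotv y (n1 b) -> 0 < dotv y (n1 a).
Proof.
move=> aA bA S0 pab xa xb yb.
have ab : a <> b by move=> ab; rewrite ab ltxx in pab.
have [H [c [HA0 c0 E1]]] := A1_normal_diff aA bA ab.
have diff z : dotv z (n1 b) - dotv z (n1 a) = c * dotv z (nu0 H).
  by rewrite -dotvNr -dotvDr E1 dotvZr.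
have pH := (hn0 HA0).2.
have c_lt0 : c < 0.
  by rewrite -(nmulr_lgt0 c pH) -diff subr_gt0.
have xH : 0 < dotv x (nu0 H).
  rewrite -(nmulr_rlt0 (dotv x (nu0 H)) c_lt0) -diff; rewrite -leNgt in xb; lra.
have := S0 _ HA0 xH; rewrite -(nmulr_rlt0 (dotv y (nu0 H)) c_lt0) -diff; lra.
Qed.

(** The constants: [c] makes the functionals [g + c v] nonnegative on [A1],
    [w] decreases fast along the ray from [p], and [e] makes the contribution of
    [A1] to any coordinate [g + c v] at most the gap [d] for [A0]. *)
Lemma step_embeds f : embeds A0 p nu0 f ->
  exists nu c, embeds A p nu (v :: [seq g + c *: v | g <- f]).
Proof.
move=> emb0; have [d d0 gap] := embeds_gap emb0; case: emb0 => _ nn0 inj0 _.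
have [w [w0 wdom]] :=
  dominating_weights (enum_fset A1) (fun H => dotv p (n1 H)).
have [c _ hc] :=
  seq_upper_bound [seq - dotv g (n1 H) | g <- f, H <- enum_fset A1].
have shift_ge0 g H : g \in f -> H \in A1 -> 0 <= dotv (g + c *: v) (n1 H).
  move=> gf HA; have [_ _ vH] := hn1 HA.
  rewrite dotvDl dotvZl vH mulr1 addrC -lerBlDr sub0r.
  by apply: hc; apply: allpairs_f.
pose tot g := \sum_(H <- enum_fset A1) dotv (g + c *: v) (w H *: n1 H).
have [M M0 hM] := seq_upper_bound [seq tot g | g <- f].
pose e := d / M; have e0 : 0 < e by rewrite divr_gt0.
have eM : e * M = d by rewrite /e divfK ?gt_eqF.
pose nu H := if H \in A0 then nu0 H else (e * w H) *: n1 H.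
have nuA0 H : H \in A0 -> nu H = nu0 H by rewrite /nu => ->.
have nuA1 H : H \in A1 -> nu H = (e * w H) *: n1 H.
  rewrite /nu; case: ifP => // HA0.
  by have /fdisjointP/(_ _ HA0)/negPf-> := dis.
have ew0 H : 0 < e * w H by rewrite mulr_gt0.
have nuA1_gt0 H x : H \in A1 -> (0 < dotv x (nu H)) = (0 < dotv x (n1 H)).
  by move=> HA; rewrite nuA1 // dotvZr pmulr_rgt0.
pose Z1 x := \sum_(H <- enum_fset A1 | 0 < dotv x (n1 H)) (e * w H) *: n1 H.
have ZE x : positive_sum A nu x = positive_sum A0 nu0 x + Z1 x.
  rewrite /positive_sum AE big_fsetU_disjoint //; congr (_ + _).
    rewrite big_seq_cond [RHS]big_seq_cond; apply: eq_big => H.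
      by case: (boolP (H \in _)) => //= HA; rewrite nuA0.
    by case/andP => HA _; rewrite nuA0.
  rewrite big_seq_cond [RHS]big_seq_cond; apply: eq_big => H.
    by case: (boolP (H \in _)) => //= HA; rewrite nuA1_gt0.
  by case/andP => HA _; rewrite nuA1.
have vZ0 x : dotv v (positive_sum A0 nu0 x) = 0.
  rewrite dotv_sumr big_seq_cond; apply: big1 => H /andP[HA _].
  by apply: (v_A0 HA); case: (hn0 HA) => -[].
have vZ1 x : dotv v (Z1 x) =
    e * \sum_(H <- enum_fset A1 | 0 < dotv x (n1 H)) w H.
  rewrite dotv_sumr mulr_sumr big_seq_cond [RHS]big_seq_cond.
  by apply: eq_bigr => H /andP[/hn1[_ _ vH] _]; rewrite dotvZr vH mulr1.
have gZ1 g x : g \in f -> 0 <= dotv (g + c *: v) (Z1 x) <= d.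
  move=> gf.
  have pos H : H \in A1 -> 0 <= dotv (g + c *: v) ((e * w H) *: n1 H).
    by move=> HA; rewrite dotvZr mulr_ge0 ?(ltW (ew0 _)) // shift_ge0.
  rewrite dotv_sumr; apply/andP; split.
    by rewrite big_seq_cond; apply: sumr_ge0 => H /andP[HA _]; exact: pos.
  rewrite -eM; apply: le_trans (_ : e * tot g <= _); last first.
    by rewrite ler_pM2l // (hM _ (map_f tot gf)).
  rewrite mulr_sumr big_mkcond big_seq [leRHS]big_seq; apply: ler_sum => H HA.
  have := pos _ HA; rewrite !dotvZr -mulrA.
  by case: ifP.
have shift_f g : g \in f -> g + c *: v \in v :: [seq g + c *: v | g <- f].
  by move=> gf; rewrite inE (map_f (fun g => g + c *: v) gf) orbT.
exists nu, c; split.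
- move=> H; rewrite AE in_fsetU => /orP[HA|HA].
    by rewrite nuA0 //; exact: hn0.
  have [nH pH _] := hn1 HA; rewrite nuA1 //; split.
    by apply: is_normalZ; rewrite ?gt_eqF.
  by rewrite dotvZr pmulr_rlt0.
- move=> g H gf; rewrite AE in_fsetU => /orP[HA|HA].
    rewrite nuA0 //; have v0 : dotv v (nu0 H) = 0.
      by apply: (v_A0 HA); case: (hn0 HA) => -[].
    move: gf => /predU1P[->|/mapP[g' gf ->]]; first by rewrite v0.
    by rewrite dotvDl dotvZl v0 mulr0 addr0 nn0.
  rewrite nuA1 // dotvZr mulr_ge0 ?(ltW (ew0 _)) //.
  move: gf => /predU1P[->|/mapP[g' gf ->]]; last exact: shift_ge0.
  by have [_ _ ->] := hn1 HA; rewrite ler01.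
- move=> z zA fz; have vz : dotv v z = 0 by apply: fz; rewrite mem_head.
  apply: inj0 => [|g gf]; last first.
    have := fz (g + c *: v) (shift_f _ gf).
    by rewrite dotvDl dotvZl vz mulr0 addr0.
  (* Otherwise [z] and [Span A0] span [Span A], and [v] would vanish there. *)
  apply: contraT => zA0; have [H HA1] := A1n0.
  have sub : (Span A0 + <[z]> <= Span A)%VS.
    rewrite subv_add -memvE zA andbT.
    by apply: Span_sub => K /A0A KA; exact: orthv_Span.
  have spanE : Span A = (Span A0 + <[z]>)%VS.
    apply/eqP; rewrite eq_sym eqEdim sub /=.
    have -> : \dim (Span A) = (\dim (Span A0)).+1 := rkA.
    rewrite dimv_disjoint_sum; last first.
      apply/eqP; rewrite -subv0; apply/subvP => u; rewrite memv_cap memv0.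
      case/andP => uA0 /vlineP[t uE]; apply: contraNT zA0 => u0.
      have t0 : t != 0 by apply: contraNneq u0 => t0; rewrite uE t0 scale0r.
      by move: uA0; rewrite uE rpredZeq (negPf t0).
    have z0 : z != 0 by apply: contraNneq zA0 => ->; exact: mem0v.
    by rewrite dim_vline z0 addn1.
  have [nH _ vH] := hn1 HA1.
  have : n1 H \in Span A by apply: subvP nH.2; exact/orthv_Span/A1A.
  rewrite spanE => /memv_addP[u uA0 [_ /vlineP[t ->] n1E]].
  have := vH; rewrite n1E dotvDr dotvZr vz mulr0 addr0 (Span_perp v_A0 uA0).
  by move=> /esym/eqP; rewrite oner_eq0.
- move=> x y cx cy leZ; have leA0 : forall H, H \in A0 ->
      0 < dotv x (nu0 H) -> 0 < dotv y (nu0 H).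
    apply: gap; [exact: complementS cx | exact: complementS cy | move=> g gf].
    have := leZ (g + c *: v) (shift_f _ gf).
    rewrite !ZE ![dotv _ (_ + Z1 _)]dotvDr.
    rewrite !(dotvDl g) !dotvZl !vZ0 !mulr0 !addr0.
    rewrite -!dotvZl -!dotvDl.
    have /andP[] := gZ1 g x gf; have /andP[] := gZ1 g y gf; lra.
  move=> a; rewrite AE in_fsetU => /orP[HA|aA].
    by rewrite nuA0 //; exact: leA0.
  rewrite !nuA1_gt0 // => xa; apply: contraT => ya.
  (* The common part of the two sums cancels; the weight of [a] exceeds the
     rest of the right-hand side. *)
  have := leZ v (mem_head _ _).
  rewrite !ZE !dotvDr !vZ0 !add0r !vZ1 ler_pM2l //.
  rewrite (bigID (fun H => 0 < dotv y (n1 H))) /=.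
  rewrite [leRHS](bigID (fun H => 0 < dotv x (n1 H))) /=.
  under [in leRHS]eq_bigl do rewrite andbC.
  rewrite lerD2l leNgt => /negP[]; apply: le_lt_trans (lt_le_trans (wdom a) _).
    apply: sum_subpred => [H _|b bA /andP[yb xb]]; first exact: ltW.
    rewrite ltNge; apply: contra ya => pab.
    have ab : a <> b by move=> ab; rewrite -ab xa in xb.
    apply: (A1_inversion aA bA leA0) => //.
    by rewrite lt_neqAle pab A1_heights_distinct.
  rewrite [leRHS]big_mkcond (bigD1_seq a) ?fset_uniq //= xa ya /=.
  by rewrite lerDl sumr_ge0 // => H _; case: ifP => // _; exact: ltW.
Qed.

End Order.

Lemma embeddable_step : embeddable A0 p -> embeddable A p.
Proof.
case=> nu0 [f [sz_f emb0]]; have [n1 hn1] := normalized_normals.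
have hn0 : forall H, H \in A0 -> is_normal H (nu0 H) /\ dotv p (nu0 H) < 0.
  by case: emb0.
have [nu [c emb]] := step_embeds hn0 hn1 emb0.
by exists nu, (v :: [seq g + c *: v | g <- f]); rewrite /= size_map sz_f rkA.
Qed.

End Step.

(** * Ranks one and two *)

Lemma Span_fset0 : Span (fset0 : {fset {vspace E}}) = 0%VS.
Proof. by rewrite /Span big_nil. Qed.

Lemma Span_fset1 H : Span [fset H]%fset = orthv H.
Proof. by rewrite /Span big_seq_fset1. Qed.

Lemma rank_fset1 H : (\dim H).+1 = n -> rank [fset H]%fset = 1%N.
Proof.
move=> dH; have [u nu] := normal_exists dH.
by rewrite /rank Span_fset1 (orthv_vline dH nu) dim_vline nu.1.
Qed.

Lemma embeddable0 p : embeddable fset0 p.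
Proof.
exists (fun=> 0), [::]; split; first by rewrite /rank Span_fset0 dimv0.
split => // z; by rewrite Span_fset0 memv0 => /eqP.
Qed.

(** The step from the empty arrangement, along the ray from [p] through the
    origin. *)
Lemma embeddable1 H p : (\dim H).+1 = n -> complement [fset H]%fset p ->
  embeddable [fset H]%fset p.
Proof.
move=> dH cp.
have hA : hyperplanes [fset H]%fset by move=> K /fset1P ->.
apply: (@embeddable_step _ fset0 [fset H]%fset p (- p)) => //.
- by rewrite fset0U.
- by rewrite fdisjoint0X.
- by exists H; rewrite fset11.
- by rewrite rank_fset1 // /rank Span_fset0 dimv0.
- move=> K KA; have [u [nu pu]] := directed_normal hA cp KA.
  by exists u; rewrite dotvNl oppr_gt0.
- by move=> H1 H2 /fset1P -> /fset1P ->.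
- exact: embeddable0.
Qed.

Lemma rank1_fset1 A :
  hyperplanes A -> rank A = 1%N -> exists H, A = [fset H]%fset.
Proof.
move=> hA rk; have [A0|[H HA]] := fset_0Vmem A.
  by move: rk; rewrite A0 /rank Span_fset0 dimv0.
have SpanE K u : K \in A -> is_normal K u -> Span A = <[u]>%VS.
  move=> KA nu; apply/esym/eqP; rewrite -(orthv_vline (hA _ KA) nu).
  rewrite eqEdim orthv_Span //= [leqLHS]rk (orthv_vline (hA _ KA) nu).
  by rewrite dim_vline nu.1.
have [u nu] := normal_exists (hA _ HA).
exists H; apply/fsetP => K; rewrite in_fset1; apply/idP/eqP => [KA|-> //].
have [w nw] := normal_exists (hA _ KA).
apply: (hyperplane_inj (hA _ KA) (hA _ HA) _ nu); split; first exact: nu.1.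
rewrite (orthv_vline (hA _ KA) nw) -(SpanE _ _ KA nw) (SpanE _ _ HA nu).
exact: memv_line.
Qed.

(** Normalised by [<p, _> = -1], the normals lie on an affine line with
    direction [w].  The extreme one in this direction belongs to a wall [m] of
    the base region, and the step splits [m] off.  The vector [v] is the
    combination of [p] and [w] that is orthogonal to the normal of [m] and
    decreasing along the line. *)
Lemma embeddable2 A p : hyperplanes A -> complement A p -> rank A = 2%N ->
  embeddable A p.
Proof.
move=> hA cp rk.
have ex_n H : exists u, H \in A -> is_normal H u /\ dotv p u = -1.
  have [HA|_] := boolP (H \in A); last by exists 0.
  have [u [nu pu]] := directed_normal hA cp HA.
  exists ((- dotv p u)^-1 *: u) => _; split.
    by apply: is_normalZ; rewrite // invr_eq0 oppr_eq0 lt_eqF.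
  by rewrite dotvZr invrN mulNr mulVf // lt_eqF.
have [nu hnu] := choice ex_n.
have nu_inj H K : H \in A -> K \in A -> nu H = nu K -> H = K.
  move=> HA KA E1; have [nH _] := hnu H HA; have [nK _] := hnu K KA.
  by apply: (hyperplane_inj (hA _ HA) (hA _ KA) nH); rewrite E1.
have [A0|[a aA]] := fset_0Vmem A.
  by move: rk; rewrite A0 /rank Span_fset0 dimv0.
have [b bA ab] : exists2 b, b \in A & b != a.
  apply: contrapT => no_b.
  have AE : A = [fset a]%fset.
    apply/fsetP => K; rewrite in_fset1; apply/idP/eqP => [KA|-> //].
    by apply: contrapT => /eqP Ka; apply: no_b; exists K.
  by move: rk; rewrite AE rank_fset1 // hA.
pose w := nu b - nu a.
have w0 : w != 0 by rewrite subr_eq0; apply: contraNneq ab => /nu_inj ->.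
have pw : dotv p w = 0.
  by rewrite dotvDr dotvNr (hnu b bA).2 (hnu a aA).2 subrr.
have aS : nu a \in Span A by apply: subvP (orthv_Span aA) _ (hnu a aA).1.2.
have wS : w \in Span A.
  by rewrite rpredB //; apply: subvP (orthv_Span bA) _ (hnu b bA).1.2.
clearbody w; have nuE H : H \in A -> exists t, nu H = nu a + t *: w.
  move=> HA.
  have sub : (<[nu a]> + <[w]> <= Span A)%VS.
    by rewrite subv_add -!memvE aS.
  have SpanE : Span A = (<[nu a]> + <[w]>)%VS.
    apply/eqP; rewrite eq_sym eqEdim sub [leqLHS]rk dimv_disjoint_sum.
      by rewrite !dim_vline w0 (hnu a aA).1.1.
    apply/eqP; rewrite -subv0; apply/subvP => u; rewrite memv_cap memv0.
    case/andP => /vlineP[s uE] /vlineP[t uE'].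
    have : dotv p u = 0 by rewrite uE' dotvZr pw mulr0.
    rewrite uE dotvZr (hnu a aA).2 mulrN1 => /eqP; rewrite oppr_eq0 => /eqP ->.
    by rewrite scale0r.
  have : nu H \in Span A by apply: subvP (orthv_Span HA) _ (hnu H HA).1.2.
  rewrite SpanE => /memv_addP[_ /vlineP[s ->] [_ /vlineP[t ->] HE]].
  exists t; have := (hnu H HA).2; rewrite HE !dotvE (hnu a aA).2 pw mulr0 addr0.
  by rewrite mulrN1 => /oppr_inj ->; rewrite scale1r.
have diffE H K : H \in A -> K \in A -> exists t, nu H = nu K + t *: w.
  move=> /nuE[s ->] /nuE[t ->]; exists (s - t).
  by rewrite -addrA -scalerDl subrKC.
have [m mA hm] := seq_argmax (fun H => dotv w (nu H)) aA.
pose v := - dotv w (nu m) *: p - w.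
have vE H : H \in A -> dotv v (nu H) = dotv w (nu m) - dotv w (nu H).
  by move=> HA; rewrite !dotvE (hnu H HA).2 mulrN1 opprK.
apply: (@embeddable_step A [fset m]%fset (A `\ m)%fset p v) => //.
- by rewrite fsetD1K.
- by rewrite fdisjoint1X in_fsetD1 eqxx.
- have [am|am] := eqVneq a m.
    by exists b; rewrite in_fsetD1 -am ab.
  by exists a; rewrite in_fsetD1 am.
- by rewrite rk rank_fset1 // hA.
- move=> H u /fset1P -> um.
  have [c ->] := orthv_line (hA _ mA) (hnu m mA).1 um.
  by rewrite dotvZr vE // subrr mulr0.
- move=> H; rewrite in_fsetD1 => /andP[Hm HA]; exists (nu H).
  have [nH pH] := hnu H HA; split; rewrite ?pH ?ltrN10 //.
  rewrite vE // subr_gt0 lt_neqAle hm // andbT; apply: contraNneq Hm => wE.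
  have [t E1] := diffE H m HA mA.
  move: wE; rewrite E1 dotvDr dotvZr => /eqP.
  rewrite -subr_eq0 addrC addKr mulf_eq0 (gt_eqF (dotvv_gt0 w0)) orbF.
  move=> /eqP t0.
  by apply/eqP/nu_inj => //; rewrite E1 t0 scale0r addr0.
- move=> H K; rewrite !in_fsetD1 => /andP[_ HA] /andP[_ KA] HK.
  exists m; first exact: fset11.
  apply/subvP => z; rewrite memv_cap (mem_hyperplane (hA _ HA) (hnu H HA).1).
  rewrite (mem_hyperplane (hA _ KA) (hnu K KA).1).
  rewrite (mem_hyperplane (hA _ mA) (hnu m mA).1) => /andP[/eqP zH /eqP zK].
  have [t E1] := diffE K H KA HA; have [s E2] := diffE m H mA HA.
  have t0 : t != 0.
    apply/eqP => t0; apply/HK/esym/nu_inj => //; by rewrite E1 t0 scale0r addr0.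
  move: zK; rewrite E1 dotvDr zH add0r dotvZr => /eqP.
  rewrite mulf_eq0 (negPf t0) E2 dotvDr zH add0r dotvZr => /eqP ->.
  by rewrite mulr0.
- by apply: embeddable1; [exact: hA | apply: complementS cp; rewrite fsub1set].
Qed.

(** * The direction of a splitting *)

Section SplittingDirection.
Variables (A A0 A1 : {fset {vspace E}}).
Hypotheses (hA : hyperplanes A) (AE : A = (A0 `|` A1)%fset).
Hypotheses (dis : [disjoint A0 & A1]%fset) (rkA : rank A = (rank A0).+1).
Hypothesis modA : forall H1 H2, H1 \in A1 -> H2 \in A1 -> H1 <> H2 ->
  exists2 H, H \in A0 & (H1 :&: H2 <= H)%VS.

Let A1A H : H \in A1 -> H \in A. Proof. by rewrite AE in_fsetU orbC => ->. Qed.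
Let A0A H : H \in A0 -> H \in A. Proof. by rewrite AE in_fsetU => ->. Qed.

(** Some [H1] in [A1] has a normal outside [Span A0]; [v] is the component of
    this normal orthogonal to [Span A0].  If [v] were orthogonal to the normal
    of another [H] in [A1], the hyperplane of [A0] in the pencil of [H] and
    [H1] would be [H] itself. *)
Lemma splitting_direction : exists v,
  (forall H u, H \in A0 -> u \in orthv H -> dotv v u = 0) /\
  (forall H u, H \in A1 -> is_normal H u -> dotv v u != 0).
Proof.
have [H1 HA1 H1n] : exists2 H, H \in A1 & ~~ (orthv H <= Span A0)%VS.
  apply: contrapT => no_H; have: (Span A <= Span A0)%VS.
    apply: Span_sub => H; rewrite AE in_fsetU => /orP[HA0|HA1].
      exact: orthv_Span.
    by apply: contrapT => /negP nH; apply: no_H; exists H.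
  by move=> /dimvS; rewrite [leqLHS]rkA ltnn.
have [n1 nH1] := normal_exists (hA (A1A HA1)).
rewrite (orthv_vline (hA (A1A HA1)) nH1) -memvE in H1n.
have [u [v [uA0 vo n1E]]] := orthv_decomp (Span A0) n1.
have v_A0 H z : H \in A0 -> z \in orthv H -> dotv v z = 0.
  move=> HA0 zH; rewrite dotvC; move: vo => /orthvP; apply.
  exact: subvP (orthv_Span HA0) _ zH.
have v0 : v != 0 by apply: contraNneq H1n => v0; rewrite n1E v0 addr0.
have vn1 : dotv v n1 != 0.
  by rewrite n1E dotvDr (Span_perp v_A0 uA0) add0r gt_eqF // dotvv_gt0.
exists v; split=> // H z HA nz; have [HH1|/eqP HH1] := eqVneq H H1.
  rewrite HH1 in nz; have [a zE] := orthv_line (hA (A1A HA1)) nH1 nz.2.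
  rewrite zE dotvZr mulf_neq0 //; apply: contraTneq nz.1 => a0.
  by rewrite zE a0 scale0r eqxx.
have [K KA0 sub] := modA HA HA1 HH1.
have [m nm] := normal_exists (hA (A0A KA0)).
have [s [t mE]] :=
  normal_pencil (hA (A1A HA)) (hA (A1A HA1)) (hA (A0A KA0)) nz nH1 nm sub.
apply: contraTneq (HA) => vz.
have := v_A0 _ _ KA0 nm.2; rewrite mE !dotvE vz mulr0 add0r => /eqP.
rewrite mulf_eq0 (negPf vn1) orbF => /eqP t0.
rewrite t0 scale0r addr0 in mE.
have s0 : s != 0 by apply: contraTneq nm.1 => s0; rewrite mE s0 scale0r eqxx.
have nHm : is_normal H m by rewrite mE; exact: is_normalZ.
have KH := hyperplane_inj (hA (A0A KA0)) (hA (A1A HA)) nm nHm.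
by move/fdisjointP: dis => /(_ _ KA0); rewrite KH.
Qed.

(** The point [p + t v] for large [t]: on [A0] it has the signs of [p], on
    [A1] those of [v]. *)
Lemma far_point p v : complement A p ->
    (forall H u, H \in A0 -> u \in orthv H -> dotv v u = 0) ->
    (forall H u, H \in A1 -> is_normal H u -> dotv v u != 0) ->
  exists x, [/\ complement A x, chamber A0 p x
    & forall H u, H \in A1 -> is_normal H u -> (0 < dotv x u) = (0 < dotv v u)].
Proof.
move=> cp v_A0 v_A1.
have ex_n H : exists u, H \in A -> is_normal H u.
  have [HA|_] := boolP (H \in A); last by exists 0.
  by have [u nu] := normal_exists (hA HA); exists u.
have [nu hnu] := choice ex_n.
have [t t0 ht] := seq_upper_bound
  [seq `|dotv p (nu H)| / `|dotv v (nu H)| + 1 | H <- enum_fset A1].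
have big H u : H \in A1 -> is_normal H u -> `|dotv p u| < t * `|dotv v u|.
  move=> HA nHu; have nH := hnu H (A1A HA).
  have [a uE] := orthv_line (hA (A1A HA)) nH nHu.2.
  have a0 : a != 0 by apply: contraTneq nHu.1 => a0; rewrite uE a0 scale0r eqxx.
  rewrite uE !dotvZr !normrM mulrCA ltr_pM2l ?normr_gt0 //.
  rewrite -ltr_pdivrMr ?normr_gt0 ?(v_A1 _ _ HA nH) //.
  by apply: lt_le_trans (ht _ (map_f _ HA)); rewrite ltrDl ltr01.
have xE H u : H \in A1 -> is_normal H u ->
    (0 < dotv (p + t *: v) u) = (0 < dotv v u).
  move=> HA nHu; have := big H u HA nHu; have := v_A1 H u HA nHu.
  rewrite !dotvE neq_lt => /orP[vu|vu].
    rewrite (ltr0_norm vu) mulrN ltr_norml opprK.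
    rewrite (ltNge 0 (dotv v u)) (ltW vu) /=.
    by move=> /andP[_ lt_p]; apply/negbTE; rewrite -leNgt; lra.
  rewrite (gtr0_norm vu) ltr_norml vu => /andP[lt_p _]; lra.
exists (p + t *: v); split=> //.
- move=> H HA; have nH := hnu H HA; rewrite (mem_hyperplane (hA HA) nH).
  move: (HA); rewrite AE in_fsetU => /orP[HA0|HA1].
    rewrite !dotvE (v_A0 _ _ HA0 nH.2) mulr0 addr0.
    exact: complementP hA cp HA nH.
  apply/eqP => px0; have := big _ _ HA1 nH; move/eqP: px0.
  rewrite !dotvE addr_eq0 => /eqP ->; rewrite normrN normrM (gtr0_norm t0).
  by rewrite ltxx.
- move=> H u HA0 nHu; rewrite !dotvE (v_A0 _ _ HA0 nHu.2) mulr0 addr0.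
  by rewrite -expr2 exprn_even_gt0 //= (complementP hA cp (A0A HA0)).
Qed.

End SplittingDirection.

(** If [v] took both signs on the directed normals of [A1], the regions far
    away from [p] in the directions [v] and [-v] would be incomparable. *)
Lemma chain_direction A A0 A1 p : hyperplanes A -> complement A p ->
    A = (A0 `|` A1)%fset -> [disjoint A0 & A1]%fset -> rank A = (rank A0).+1 ->
    (forall H1 H2, H1 \in A1 -> H2 \in A1 -> H1 <> H2 ->
       exists2 H, H \in A0 & (H1 :&: H2 <= H)%VS) ->
    (forall Q1 Q2, region A Q1 -> region A Q2 ->
       Q1 `<=` closure (chamber A0 p) -> Q2 `<=` closure (chamber A0 p) ->
       region_le A (closure (chamber A p)) Q1 Q2 \/
       region_le A (closure (chamber A p)) Q2 Q1) ->
  exists v, (forall H u, H \in A0 -> u \in orthv H -> dotv v u = 0) /\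
    (forall H u, H \in A1 -> is_normal H u -> dotv p u < 0 -> 0 < dotv v u).
Proof.
move=> hA cp AE dis rkA modA chain.
have A0sub : (A0 `<=` A)%fset by rewrite AE fsubsetUl.
have A1A H : H \in A1 -> H \in A by rewrite AE in_fsetU orbC => ->.
have [v [v_A0 v_A1]] := splitting_direction hA AE dis rkA modA.
have Nv_A0 H u : H \in A0 -> u \in orthv H -> dotv (- v) u = 0.
  by move=> HA uH; rewrite dotvNl (v_A0 _ _ HA uH) oppr0.
have Nv_A1 H u : H \in A1 -> is_normal H u -> dotv (- v) u != 0.
  by move=> HA nHu; rewrite dotvNl oppr_eq0 (v_A1 H u HA nHu).
have [x [cx px vx]] := far_point hA AE cp v_A0 v_A1.
have [y [cy py vy]] := far_point hA AE cp Nv_A0 Nv_A1.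
have sub z : chamber A0 p z ->
    closure (chamber A z) `<=` closure (chamber A0 p).
  by move=> pz; apply: closure_subset; exact: chamber_trans pz.
have le_imp z1 z2 H u : complement A z1 -> complement A z2 ->
    H \in A1 -> is_normal H u -> dotv p u < 0 ->
    region_le A (closure (chamber A p)) (closure (chamber A z1))
      (closure (chamber A z2)) -> 0 < dotv z1 u -> 0 < dotv z2 u.
  move=> c1 c2 /A1A HA nHu pu /fsubsetP/(_ H).
  by rewrite !(mem_sepset hA cp _ HA nHu pu).
have := chain _ _ (chamber_region hA cx) (chamber_region hA cy)
  (sub x px) (sub y py).
case=> le_xy; [exists (- v) | exists v]; split => // H u HA nHu pu.
- have := le_imp _ _ _ _ cx cy HA nHu pu le_xy; rewrite (vx H) // (vy H) //.
  have := v_A1 _ _ HA nHu; rewrite neq_lt => /orP[vu _|vu ->] //.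
  by rewrite dotvNl oppr_gt0.
- have := le_imp _ _ _ _ cy cx HA nHu pu le_xy; rewrite (vx H) // (vy H) //.
  have := v_A1 _ _ HA nHu; rewrite neq_lt => /orP[vu ->|vu _] //.
  by rewrite dotvNl oppr_gt0.
Qed.

(** * The induction and the passage to bases *)

Lemma canonical_embeddable A B : canonical_base A B -> hyperplanes A /\
  forall p, complement A p -> B = closure (chamber A p) -> embeddable A p.
Proof.
elim=> {A B} [A B [_ hA] rk _|A A0 A1 B B0 [_ hA] _ [AE dis rkA modA] _ _
  regB0 BB0 _ [hA0 IH] chain]; split=> // p cp BE.
  case: rk => rk; last exact: embeddable2.
  have [H AE] := rank1_fset1 hA rk.
  by rewrite AE; apply: embeddable1; [apply: hA | ]; rewrite ?AE ?fset11 -?AE.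
have A0sub : (A0 `<=` A)%fset by rewrite AE fsubsetUl.
have cp0 := complementS A0sub cp.
have [x cx B0E] := region_chamber hA0 regB0.
have xp : chamber A0 x p.
  have := interiorS BB0; rewrite BE B0E !interior_closure_chamber //.
  by apply; exact: chamber_refl.
have B0p : B0 = closure (chamber A0 p).
  rewrite B0E; congr closure; apply/seteqP; split.
    exact: chamber_trans (fsubset_refl _) (chamber_sym xp).
  exact: chamber_trans (fsubset_refl _) xp.
have mod2 H1 H2 : H1 \in A1 -> H2 \in A1 -> H1 <> H2 ->
    exists2 H, H \in A0 & (H1 :&: H2 <= H)%VS.
  move=> HA1 HA2 H12.
  by have [H [[HA0 sub] _]] := modA _ _ HA1 HA2 H12; exists H.
rewrite BE B0p in chain.
have [v [v_A0 v_A1]] := chain_direction hA cp AE dis rkA mod2 chain.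
apply: (embeddable_step hA AE dis) => //; last exact: IH.
- have [A10|[H HA]] := fset_0Vmem A1; last by exists H.
  by move: rkA; rewrite AE A10 fsetU0 => /n_Sn.
- exact: v_A0.
- move=> H HA1; have HA : H \in A by rewrite AE in_fsetU HA1 orbT.
  have [u [nu pu]] := directed_normal hA cp HA.
  by exists u; split => //; exact: (v_A1 H).
Qed.

Lemma embeddable_zonotopal A p : hyperplanes A -> complement A p ->
  embeddable A p -> has_zonotopal_embedding A (closure (chamber A p)) (rank A).
Proof.
move=> hA cp [nu [f0 [sz_f [hnu nn inj ord]]]].
pose f : (rank A).-tuple E := Tuple (introT eqP sz_f).
have [b [bS bE]] := @dual_basis _ _ _ (Span A) f erefl inj.
have sepE q : complement A q ->
    sepset A (closure (chamber A p)) (closure (chamber A q)) =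
    [fset H in A | 0 < dotv q (nu H)]%fset.
  move=> cq; apply/fsetP => H; have [HA|HnA] := boolP (H \in A).
    by rewrite (mem_sepset hA cp cq HA (hnu H HA).1 (hnu H HA).2) !inE HA.
  by rewrite /sepset !inE (negPf HnA).
have zonoE q : complement A q ->
    zono A (closure (chamber A p)) nu (closure (chamber A q)) =
    positive_sum A nu q.
  by move=> cq; rewrite /zono sepE // big_fset.
have sumS q : positive_sum A nu q \in Span A.
  rewrite /positive_sum big_seq_cond; apply: rpred_sum => H /andP[HA _].
  by apply: subvP (orthv_Span HA) _ _; have [[]] := hnu H HA.
exists nu, b; split => //.
- split=> [H HA|Q H /(region_chamber hA)[q cq ->] HA].
    exact: (hnu H HA).1.
  have [nH pH] := hnu H HA.
  rewrite interior_closure_chamber // (mem_sepset hA cp cq HA nH pH).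
  split=> [qH x cqx|]; first by rewrite (chamber_gt0 cqx HA nH).
  by apply; exact: chamber_refl.
move=> Q1 Q2 /(region_chamber hA)[x cx ->] /(region_chamber hA)[y cy ->].
rewrite /region_le !sepE // !zonoE //; split=> [/fsubsetP le_xy i|le_Z].
  rewrite !bE // !dotv_sumr; apply: sum_subpred => H HA.
    by apply: nn => //; exact: mem_tnth.
  by move=> xH; have := le_xy H; rewrite !inE /= HA => /(_ xH).
apply/fsubsetP => H; rewrite !inE => /andP[HA xH]; rewrite HA /=.
apply: (ord x y) => // g /(tnthP f)[i ->].
by rewrite -!bE.
Qed.

End Embeddings.

Theorem theorem7p5 (R : realType) (n d : nat)
    (A : {fset {vspace 'rV[R]_n}}) (B : set 'rV[R]_n) :
  supersolvable A -> rank A = d -> canonical_base A B ->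
  has_zonotopal_embedding A B d.
Proof.
move=> _ <- canB; have [hA emb] := canonical_embeddable canB.
have [p cp BE] : exists2 p, complement A p & B = closure (chamber A p).
  by apply: region_chamber => //; case: canB.
by rewrite BE; apply: embeddable_zonotopal => //; exact: emb.
Qed.
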